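(* Let $G$ be an infinite discrete countable group and let $(X,G)$ be a tame minimal $G$-system. Let $(H,G)$ be the maximal equicontinuous factor of $(X,G)$ with factor map $\pi:X\to H$, and let $\nu$ be the Haar measure on $H$. Assume $K\in\mathbb{N}$ and $\pi$ is almost $K$ to one. Then $\nu(\{h\in H:|\pi^{-1}(h)|=K\})=1$.
   Context: A $G$-system $(X,G)$ is a compact metric space on which $G$ acts by homeomorphisms; minimal means every orbit is dense. The enveloping (Ellis) semigroup $E(X)$ is the closure of $\{x\mapsto gx: g\in G\}$ in $X^X$ with the product topology; $(X,G)$ is tame if $E(X)$ is separable and Fréchet. The maximal equicontinuous factor $(H,G)$ is $X/S_{eq}$, where $S_{eq}$ is the smallest closed $G$-invariant equivalence relation on $X$ whose quotient system is equicontinuous, and $\pi$ is the quotient map; $\nu$ is the unique $G$-invariant Borel probability measure on $H$ (the Haar measure). A factor map $\pi:X\to H$ is almost $K$ to one if the set $\{h\in H:|\pi^{-1}(h)|=K\}$ is residual (contains a dense $G_\delta$) in $H$. *)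

(* Defs.v *)
From HB Require Import structures.
From mathcomp Require Import all_boot all_order all_algebra.
From mathcomp Require Import all_classical all_reals all_analysis.
Set Implicit Arguments. Unset Strict Implicit. Unset Printing Implicit Defensive.
Import Order.TTheory GRing.Theory Num.Theory.
Local Open Scope classical_set_scope.
Local Open Scope ring_scope.

Definition is_group {G : Type} (mul : G -> G -> G) (one : G) (inv : G -> G) :=
  [/\ (forall a b c, mul a (mul b c) = mul (mul a b) c),
      (forall a, mul one a = a), (forall a, mul a one = a),
      (forall a, mul (inv a) a = one) & (forall a, mul a (inv a) = one)].

Definition compact_metric {R : realType} (X : pseudoMetricType R) :=
  compact [set: X] /\ hausdorff_space X.

(* G acts on X by homeomorphisms (continuous left action; each act g is a
   homeomorphism, with inverse act (inv g)). *)
Definition cont_action {G : Type} (mul : G -> G -> G) (one : G)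
  {X : topologicalType} (act : G -> X -> X) :=
  [/\ (forall x, act one x = x),
      (forall g h x, act (mul g h) x = act g (act h x)) &
      (forall g, continuous (act g))].

Definition orbit {G : Type} {X : Type} (act : G -> X -> X) (x : X) : set X :=
  [set act g x | g in [set: G]].

Definition minimal_system {G : Type} {X : topologicalType} (act : G -> X -> X) :=
  forall x : X, closure (orbit act x) = [set: X].

Definition enveloping {G : Type} {X : topologicalType} (act : G -> X -> X)
  : set {ptws X -> X} :=
  @closure {ptws X -> X} (range act).

Definition tame {G : Type} {X : topologicalType} (act : G -> X -> X) :=
  let E := enveloping act in
  (exists D : set {ptws X -> X}, countable D /\ D `<=` E /\ E `<=` closure D) /\
  (forall (A : set {ptws X -> X}), A `<=` E ->
     forall f : {ptws X -> X}, E f -> closure A f ->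
     exists u : nat -> {ptws X -> X}, (forall n, A (u n)) /\ u @ \oo --> f).

Definition equicontinuous_system {G : Type} {R : realType}
  {Y : pseudoMetricType R} (act : G -> Y -> Y) :=
  forall e : R, 0 < e -> exists2 d : R, 0 < d &
    forall y y' : Y, ball y d y' -> forall g, ball (act g y) e (act g y').

Definition factor_map {G : Type} {X Y : topologicalType}
  (actX : G -> X -> X) (actY : G -> Y -> Y) (p : X -> Y) :=
  [/\ continuous p, (forall y, exists x, p x = y) &
      (forall g x, p (actX g x) = actY g (p x))].

Definition closed_invariant_equivalence {G : Type} {X : topologicalType}
  (act : G -> X -> X) (S : set (X * X)) :=
  [/\ closed S,
      (forall g x y, S (x, y) -> S (act g x, act g y)),
      (forall x, S (x, x)),
      (forall x y, S (x, y) -> S (y, x)) &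
      (forall x y z, S (x, y) -> S (y, z) -> S (x, z))].

(* The quotient system X/S is (up to conjugacy) an equicontinuous compact
   metric G-system: i.e. S is the kernel of a factor map onto an
   equicontinuous compact metric G-system. *)
Definition has_equicontinuous_quotient {G : Type} (mul : G -> G -> G) (one : G)
  {R : realType} {X : pseudoMetricType R} (act : G -> X -> X) (S : set (X * X)) :=
  exists (Y : pseudoMetricType R) (actY : G -> Y -> Y) (psi : X -> Y),
    [/\ compact_metric Y, cont_action mul one actY, equicontinuous_system actY,
        factor_map act actY psi &
        forall x y, S (x, y) <-> psi x = psi y].

Definition is_S_eq {G : Type} (mul : G -> G -> G) (one : G)
  {R : realType} {X : pseudoMetricType R} (act : G -> X -> X) (S : set (X * X)) :=
  [/\ closed_invariant_equivalence act S,
      has_equicontinuous_quotient mul one act S &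
      forall S' : set (X * X), closed_invariant_equivalence act S' ->
        has_equicontinuous_quotient mul one act S' -> S `<=` S'].

(* (H, actH) with pi : X -> H is the maximal equicontinuous factor: H is a
   compact metric G-system and pi is a factor map whose kernel is S_eq,
   i.e. (H, pi) is (conjugate to) the quotient X / S_eq with quotient map. *)
Definition max_equicontinuous_factor {G : Type} (mul : G -> G -> G) (one : G)
  {R : realType} {X H : pseudoMetricType R}
  (act : G -> X -> X) (actH : G -> H -> H) (pi : X -> H) :=
  [/\ compact_metric H, cont_action mul one actH, factor_map act actH pi &
      is_S_eq mul one act [set p : X * X | pi p.1 = pi p.2]].

Notation borel T := (g_sigma_algebraType (@open T)).

(* nu is a G-invariant Borel probability measure on H (the Haar measure). *)
Definition invariant_borel_probability {G : Type} {R : realType}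
  {H : pseudoPMetricType R} (actH : G -> H -> H)
  (nu : {measure set (borel H) -> \bar R}) :=
  nu [set: borel H] = 1%E /\
  forall g (A : set (borel H)), measurable A ->
    nu ((actH g : borel H -> borel H) @^-1` A) = nu A.

Definition fiber_card_set {X H : Type} (pi : X -> H) (K : nat) : set H :=
  [set h | (pi @^-1` [set h] #= `I_K)%card].

Definition residual {T : topologicalType} (A : set T) :=
  exists U : nat -> set T, (forall n, open (U n) /\ dense (U n)) /\
    \bigcap_n U n `<=` A.

Definition almost_K_to_one {X H : topologicalType} (pi : X -> H) (K : nat) :=
  residual (fiber_card_set pi K).

(* Main.v *)
Require Import Defs.
From HB Require Import structures.
From mathcomp Require Import all_boot all_order all_algebra.
From mathcomp Require Import all_classical all_reals all_analysis.
From mathcomp Require Import measurable_realfun zify lra.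
Set Implicit Arguments. Unset Strict Implicit. Unset Printing Implicit Defensive.
Import Order.TTheory GRing.Theory Num.Theory.
Import numFieldNormedType.Exports.
Local Open Scope classical_set_scope.
Local Open Scope ring_scope.

(**
Every fibre has at least [K] points, by semicontinuity and Baire. A fibre over
[h] with more than [K] points meets [K+1] closed sets [B] having pairwise
disjoint closed neighbourhoods [C]; since the fibres over a dense set have only
[K] points, [h] lies in a defect set [pi(B) /\ closure(~ pi(C))] for one of
countably many pairs [(B, C)]. It remains to see that a defect set [A] is
[nu]-null. Both "the fibre meets an intermediate neighbourhood [C1]" and "the
fibre misses [C]" hold on open sets whose closures contain [A]. If
[nu A > 0], one finds inductively [g_0, g_1, ...] in [G] such that every pattern
of these two alternatives is realised along the [g_i]: a finite configuration of
sufficiently close points of [H] can be translated simultaneously into any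
neighbourhood of [A], as one sees by averaging continuous functions over
finitely many translations. Passing to limits of [K]-point fibres in [X^K], all
infinite patterns are realised by [K]-tuples, so no subsequence of [(g_i)]
converges pointwise, which contradicts the Frechet property of the enveloping
semigroup.
*)

(** * Compactness and uniformity *)

(** Otherwise the sets containing the complement of a finite union of [N x] form a proper filter,
    and a cluster point [p] of it is incompatible with [N p]. *)
Lemma compact_finite_cover (T : topologicalType) (N : T -> set T) :
  compact [set: T] -> (forall x, nbhs x (N x)) ->
  exists s : seq T, forall y, exists2 x, x \in s & N x y.
Proof.
move=> cT nN; apply: contrapT => /forallNP nos.
pose F : set_system T :=
  [set A | exists s : seq T, forall y, (forall x, x \in s -> ~ N x y) -> A y].
have FF : ProperFilter F.
  split.
    move=> [s sP]; apply: (nos s) => y; apply: contrapT => nex.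
    by apply: (sP y) => x xs Nxy; apply: nex; exists x.
  split; first by exists [::].
    move=> P Q [s sP] [t tQ]; exists (s ++ t) => y yst; split.
      by apply: sP => x xs; apply: yst; rewrite mem_cat xs.
    by apply: tQ => x xt; apply: yst; rewrite mem_cat xt orbT.
  by move=> P Q PQ [s sP]; exists s => y ys; apply: PQ; exact: sP.
have [p [_ clp]] := cT F FF filterT.
have FNp : F (~` N p) by exists [:: p] => y; apply; rewrite mem_head.
by have [y []] := clp _ _ FNp (nN p).
Qed.

(** Cluster points replace convergent subsequences, which compactness alone does not provide in
    [{ptws X -> X}]. *)
Lemma seq_cluster (T : topologicalType) (u : nat -> T) : compact [set: T] ->
  exists p : T, forall N, nbhs p N -> forall n, exists2 m, (n <= m)%N & N (u m).
Proof.
move=> cT; have [p [_ clp]] := cT (u @ \oo) _ filterT.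
exists p => N Np n.
have [|y [[m nm <-] Ny]] := clp [set u m | m in [set m | (n <= m)%N]] N _ Np.
  by exists n => // m nm; exists m.
by exists m.
Qed.

Lemma closure_ballW (R : realType) (X : pseudoMetricType R) (c : X) (r s : R) :
  0 < r -> r < s -> closure (ball c r) `<=` (ball c s)^°.
Proof.
move=> r0 rs x clx.
have e0 : 0 < (s - r) / 2 by lra.
have [y [cy xy]] := clx _ (nbhsx_ballx x _ e0).
apply: filterS (nbhsx_ballx x _ e0) => z xz.
have -> : s = r + (s - r) / 2 + (s - r) / 2 by lra.
by apply: ball_triangle xz; apply: ball_triangle cy _; exact: ball_sym.
Qed.

Lemma hausdorff_ball_eq (R : realType) (X : pseudoMetricType R) (x y : X) :
  hausdorff_space X -> (forall e : R, 0 < e -> ball x e y) -> x = y.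
Proof.
move=> hX xy; apply: hX => A B /nbhs_ballP[e /= e0 eA] /nbhs_ballP[d /= d0 dB].
by exists y; split; [exact/eA/xy|exact/dB/ballxx].
Qed.

(* The factorisation of [q] through [p] is uniformly continuous. *)
Lemma unif_factor (R : realType) (X : topologicalType) (Y Z : pseudoMetricType R)
  (p : X -> Y) (q : X -> Z) : compact [set: X] -> hausdorff_space Y ->
  continuous p -> continuous q -> (forall x x', p x = p x' -> q x = q x') ->
  forall e : R, 0 < e -> exists2 d : R, 0 < d &
    forall x x', ball (p x) d (p x') -> ball (q x) e (q x').
Proof.
move=> cX hY cp cq pq e e0; apply: contrapT => nd.
(* Bad pairs at the radii [1 / (n + 1)] cluster at some [(x, x')] with [p x = p x'], hence
   [q x = q x'], which contradicts the bad pairs nearby. *)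
have bad n : exists xx : X * X, ball (p xx.1) n.+1%:R^-1 (p xx.2) /\
    ~ ball (q xx.1) e (q xx.2).
  apply: contrapT => nex; apply: nd; exists n.+1%:R^-1; first by rewrite invr_gt0.
  move=> x x' bxx'; apply: contrapT => nb; apply: nex; by exists (x, x').
have [u uP] := choice bad.
have cXX : compact [set: X * X].
  by rewrite -setXTT; exact: compact_setX.
have [[x x'] clx] := seq_cluster u cXX.
have near (N N' : set X) : nbhs x N -> nbhs x' N' ->
    nbhs (x, x') [set z | N z.1 /\ N' z.2].
  by move=> Nx Nx'; exists (N, N').
have qxx' : q x = q x'.
  apply: pq; apply: hausdorff_ball_eq => // d d0.
  have d3 : 0 < d / 3 by lra.
  have [m] := clx _ (near _ _ (cp x _ (nbhsx_ballx (p x) _ d3))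
      (cp x' _ (nbhsx_ballx (p x') _ d3))) (Num.truncn (d / 3)^-1).
  move=> dm [/= b1 b2]; have [b3 _] := uP m.
  have b3' : ball (p (u m).1) (d / 3) (p (u m).2).
    apply: le_ball b3; rewrite -[leRHS]invrK lef_pV2 ?posrE ?invr_gt0//.
    apply/ltW/(lt_le_trans (truncnS_gt _)).
    by rewrite ler_nat.
  have -> : d = d / 3 + d / 3 + d / 3 by lra.
  apply: ball_triangle (ball_sym b2); exact: ball_triangle b1 b3'.
have e2 : 0 < e / 2 by lra.
have [m] := clx _ (near _ _ (cq x _ (nbhsx_ballx (q x) _ e2))
      (cq x' _ (nbhsx_ballx (q x') _ e2))) 0%N.
move=> _ [/= b1 b2]; have [_] := uP m; apply.
have -> : e = e / 2 + e / 2 by lra.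
apply: ball_triangle (ball_sym b1) _; by rewrite qxx'.
Qed.

(** * Averages over finitely many translations *)

Section averages.
Variables (R : realType) (G : Type) (mul : G -> G -> G) (one : G).
Variables (H : pseudoPMetricType R) (act : G -> H -> H).
Hypothesis cH : compact [set: H].
Hypothesis hH : hausdorff_space H.
Hypothesis hact : cont_action mul one act.
Hypothesis hmin : minimal_system act.
Hypothesis heq : equicontinuous_system act.

(** Indexed families with repetitions, rather than finite sets, make an average of averages again an
    average, over the product index type. *)
Definition avg (I : finType) (g : I -> G) (f : H -> R) (y : H) : R :=
  (\sum_i f (act (g i) y)) / #|I|%:R.

Lemma avg_mul (I J : finType) (g : I -> G) (h : J -> G) f y :
  avg (fun p : I * J => mul (g p.1) (h p.2)) f y = avg h (avg g f) y.
Proof.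
have [_ actM _] := hact.
rewrite /avg card_prod natrM -mulr_suml -[RHS]mulrA -invfM; congr (_ / _).
rewrite exchange_big /= pair_bigA /=.
by apply: eq_bigr => p _; rewrite actM.
Qed.

Lemma avg_le (I : finType) (g : I -> G) f f' y : (forall z, f z <= f' z) ->
  avg g f y <= avg g f' y.
Proof. by move=> ff'; rewrite ler_wpM2r// ler_sum. Qed.

Lemma avg_cst (I : finType) (g : I -> G) c y : (0 < #|I|)%N ->
  avg g (fun=> c) y = c.
Proof.
move=> I0; rewrite /avg sumr_const -[c *+ _]mulr_natr mulfK//.
by rewrite pnatr_eq0 -lt0n.
Qed.

Lemma avg_near_cst (I : finType) (g : I -> G) f c e y : (0 < #|I|)%N ->
  (forall z, `|f z - c| <= e) -> `|avg g f y - c| <= e.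
Proof.
move=> I0 fc; rewrite ler_distl -(avg_cst g (c - e) y I0) -(avg_cst g (c + e) y I0).
by apply/andP; split; apply: avg_le => z; have := fc z; rewrite ler_distl => /andP[].
Qed.

Lemma continuous_avg (I : finType) (g : I -> G) f : continuous f ->
  continuous (avg g f).
Proof.
move=> cf; have [_ _ cact] := hact.
move=> y; apply: cvgMl; apply: cvg_big => [|i _]; first exact: add_continuous.
by apply: continuous_comp; [exact: cact|exact: cf].
Qed.

(** By minimality some translation brings [y] close to [z]; the same one serves all nearby pairs,
    and [H * H] is compact. *)
Lemma uniform_return (d : R) : 0 < d ->
  exists (I : finType) (t : I -> G), forall y z, exists i, ball z d (act (t i) y).
Proof.
move=> d0; have [_ _ cact] := hact.
have d3 : 0 < d / 3 by lra.
have ex (p : H * H) : exists g, ball p.2 (d / 3) (act g p.1).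
  have : closure (Defs.orbit act p.1) p.2 by rewrite hmin.
  move=> /(_ _ (nbhsx_ballx _ _ d3)) [_ [[g _ <-] b]]; by exists g.
have [g gP] := choice ex.
pose N (p : H * H) : set (H * H) := [set q | ball q.2 d (act (g p) q.1)].
have [|p|s sP] := @compact_finite_cover _ N.
- by rewrite -setXTT; exact: compact_setX.
- exists (act (g p) @^-1` ball (act (g p) p.1) (d / 3), ball p.2 (d / 3)).
    split; last exact: nbhsx_ballx.
    exact/cact/nbhsx_ballx.
  move=> [y z] [/= b1 b2]; rewrite /N /=.
  have -> : d = d / 3 + d / 3 + d / 3 by lra.
  by apply: ball_triangle b1; apply: ball_triangle (gP p); exact: ball_sym.
exists 'I_(size s), (fun i : 'I_(size s) => g (nth (point, point) s i)) => y z.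
have [p ps pyz] := sP (y, z).
have ps' : (index p s < size s)%N by rewrite index_mem.
by exists (Ordinal ps') => /=; rewrite nth_index.
Qed.

Lemma continuous_bounded (f : H -> R) : continuous f ->
  exists M, forall y, `|f y| <= M.
Proof.
move=> cf; have [|s sP] := @compact_finite_cover _ (fun x => f @^-1` ball (f x) 1) cH.
  by move=> x; exact/cf/nbhsx_ballx.
exists (\sum_(x <- s) `|f x| + 1) => y; have [x xs /= fxy] := sP y.
have fxs : `|f x| <= \sum_(x <- s) `|f x|.
  by rewrite (big_rem x)//= lerDl sumr_ge0.
rewrite /ball /= in fxy.
by have := ler_normB (f x) (f x - f y); rewrite opprB addrC subrK; lra.
Qed.

Lemma orbit_equicontinuous (f : H -> R) (e : R) : continuous f -> 0 < e ->
  exists2 d, 0 < d & forall g y y', ball y d y' ->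
    `|f (act g y) - f (act g y')| <= e.
Proof.
move=> cf e0; have [d1 d10 fd1] : exists2 d : R, 0 < d &
    forall y y', ball y d y' -> ball (f y) e (f y').
  apply: (@unif_factor R H H R^o idfun f) => //; first by move=> y; exact: cvg_id.
  by move=> x x' /= ->.
have [d d0 hd] := heq d10; exists d => // g y y' yy'.
by apply/ltW/fd1/hd.
Qed.

Lemma avg_equicontinuous (f : H -> R) (e : R) : continuous f -> 0 < e ->
  exists2 d, 0 < d & forall (I : finType) (g : I -> G) y y', (0 < #|I|)%N ->
    ball y d y' -> `|avg g f y - avg g f y'| <= e.
Proof.
move=> cf e0; have [d d0 hd] := orbit_equicontinuous cf e0.
exists d => // I g y y' I0 yy'.
rewrite /avg -mulrBl -sumrB normrM normfV (ger0_norm (ler0n _ _)) ler_pdivrMr ?ltr0n//.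
apply: le_trans (ler_norm_sum _ _ _) _.
by rewrite mulr_natr -sumr_const; apply: ler_sum => i _; exact: hd.
Qed.

(* Kakutani's argument: the infimum of the suprema of the averages of [f] is
   approached only by averages that are nearly constant, since otherwise
   averaging once more over a uniformly returning finite set of translations
   would lower the supremum by a definite amount. *)
Lemma avg_const (f : H -> R) (e : R) : continuous f -> 0 < e ->
  exists (I : finType) (g : I -> G) (c : R),
    (0 < #|I|)%N /\ forall y, `|avg g f y - c| <= e.
Proof.
move=> cf e0; have e2 : 0 < e / 2 by lra.
pose S : set R := [set s | exists (I : finType) (g : I -> G),
  (0 < #|I|)%N /\ forall y, avg g f y <= s].
have [M fM] := continuous_bounded cf.
have S0 : has_inf S.
  split.
    exists M, unit, (fun=> one); rewrite card_unit; split => // y.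
    rewrite -[leRHS](@avg_cst unit (fun=> one) M y) ?card_unit//.
    by apply: avg_le => z; apply: le_trans (fM z); exact: ler_norm.
  exists (- M) => s [I [g [I0 gs]]]; apply: le_trans (gs point).
  rewrite -(@avg_cst _ g (- M) point)//; apply: avg_le => z.
  by have := fM z; rewrite ler_norml => /andP[].
set c := inf S.
have [d d0 hd] := avg_equicontinuous cf e2.
have [J [t tP]] := uniform_return d0.
have J0 : (0 < #|J|)%N.
  by have [i _] := tP point point; apply/card_gt0P; exists i.
have J0' : 0 < #|J|%:R :> R by rewrite ltr0n.
(* With this [eta], the excess of all [#|J|] terms over [c] is at most [e / 2] in total, the amount
   by which a single term will fall below [c]. *)
pose eta := e / 2 / #|J|%:R; have eta0 : 0 < eta by rewrite divr_gt0.
have etaJ : eta * #|J|%:R = e / 2 by rewrite divfK ?gt_eqF.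
have etae : eta <= e / 2 by rewrite ler_pdivrMr// ler_peMr ?ler1n// ltW.
have [s [I [g [I0 gs]]] sc] := inf_adherent eta0 S0.
exists I, g, c; split => // y; rewrite ler_distl; apply/andP; split; last first.
  by apply: le_trans (gs y) _; rewrite -/c in sc; lra.
rewrite leNgt; apply/negP => small.
(* Among the terms of the second average, one returns near [y] and is at most [c - e / 2], the
   others are at most [c + eta]. The resulting bound [s'] equals [c - eta / #|J|], below the
   infimum. *)
pose s' := ((c + eta) * #|J|%:R - eta - e / 2) / #|J|%:R.
have : S s'.
  exists (I * J)%type, (fun p => mul (g p.1) (t p.2)).
  rewrite card_prod muln_gt0 I0 J0; split => // z; rewrite avg_mul {1}/avg.
  rewrite ler_pM2r ?invr_gt0//.
  have [i yi] := tP z y.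
  rewrite (bigD1 i)//=.
  have h1 : avg g f (act (t i) z) <= c - e / 2.
    have := hd _ g _ _ I0 yi; rewrite ler_distl => /andP[+ _]; lra.
  have h2 : \sum_(j | j != i) avg g f (act (t j) z) <= (c + eta) * (#|J|.-1)%:R.
    rewrite mulr_natr.
    have -> : #|J|.-1 = #|[pred j | j != i]|.
      by have := cardC (pred1 i); rewrite card1 add1n => <-.
    rewrite -sumr_const; apply: ler_sum => j _.
    by apply: le_trans (gs _) _; rewrite -/c in sc; lra.
  have hJ : #|J|%:R = (#|J|.-1)%:R + 1 :> R by rewrite natr1 prednK.
  rewrite hJ mulrDr mulr1; lra.
move=> /(ge_inf (proj2 S0)); rewrite -/c ler_pdivlMr// mulrDl etaJ; lra.
Qed.

(** Averaging further keeps a nearly constant function within [e] of its constant, so the functions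
    can be treated one after the other. *)
Lemma avg_const_simul (f : nat -> H -> R) n (e : R) :
  (forall k, continuous (f k)) -> 0 < e ->
  exists (I : finType) (g : I -> G) (c : nat -> R), (0 < #|I|)%N /\
    forall k y, (k < n)%N -> `|avg g (f k) y - c k| <= e.
Proof.
move=> cf e0; elim: n => [|n [I [g [c [I0 gc]]]]].
  by exists unit, (fun=> one), (fun=> 0); rewrite card_unit.
have [J [h [c' [J0 hc']]]] := avg_const (@continuous_avg _ g _ (cf n)) e0.
exists (I * J)%type, (fun p => mul (g p.1) (h p.2)),
  (fun k => if k == n then c' else c k).
rewrite card_prod muln_gt0 I0 J0; split => // k y; rewrite ltnS leq_eqVlt avg_mul.
have [-> _|kn /= ltkn] := eqVneq k n; first exact: hc'.
by apply: avg_near_cst => // z; exact: gc.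
Qed.

End averages.

(** * The invariant measure *)

Section haar.
Variables (R : realType) (G : Type) (mul : G -> G -> G) (one : G).
Variables (H : pseudoPMetricType R) (act : G -> H -> H).
Hypothesis cH : compact [set: H].
Hypothesis hH : hausdorff_space H.
Hypothesis hact : cont_action mul one act.
Hypothesis hmin : minimal_system act.
Hypothesis heq : equicontinuous_system act.
Variable nu : {measure set (borel H) -> \bar R}.
Hypothesis hnu : invariant_borel_probability act nu.

Local Notation nuR A := (fine (nu A)).

Lemma open_borel (U : set H) : open U -> measurable (U : set (borel H)).
Proof. by move=> oU; apply: sub_sigma_algebra. Qed.

Lemma closed_borel (A : set H) : closed A -> measurable (A : set (borel H)).
Proof.
by move=> cA; rewrite -[A]setCK; apply: measurableC; by apply: open_borel; rewrite openC.
Qed.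

Lemma measurable_act g : measurable_fun setT (act g : borel H -> borel H).
Proof.
have [_ _ cact] := hact.
apply: (@measurability _ _ (borel H) (borel H) setT (act g) (@open H)) => //.
move=> _ [U oU <-]; rewrite setTI.
by apply: open_borel; apply: open_comp => // x _; exact: cact.
Qed.

Lemma nu_le1 (A : set (borel H)) : measurable A -> (nu A <= 1)%E.
Proof.
by move=> mA; have [<- _] := hnu; apply: le_measure; rewrite ?inE.
Qed.

Lemma nuRE (A : set (borel H)) : measurable A -> nu A = (nuR A)%:E.
Proof.
move=> mA; rewrite fineK// ge0_fin_numE//.
by apply: le_lt_trans (nu_le1 mA) _; rewrite ltry.
Qed.

(** Each summand is the indicator of a translate of [A], which has measure [nu A] by invariance. *)
Lemma integral_sum_indic (I : finType) (g : I -> G) (A : set (borel H)) :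
  measurable A -> (\int[nu]_y (\sum_i \1_A (act (g i) y))%:E)%E =
    (#|I|%:R * nuR A)%:E.
Proof.
move=> mA; have [nu1 nug] := hnu.
have mgA h : measurable (act h @^-1` A : set (borel H)).
  by rewrite -[X in measurable X]setTI; exact: measurable_act.
under eq_integral do rewrite -sumEFin.
rewrite ge0_integral_sum//.
- rewrite (eq_bigr (fun=> (nuR A)%:E)); last first.
    move=> i _; rewrite -nuRE// -(nug (g i)) //.
    by rewrite -[in RHS](setIT (_ @^-1` _)) -integral_indic.
  by rewrite sumEFin sumr_const mulr_natl.
- move=> i; apply/measurable_EFinP; apply: (measurable_indic (mgA (g i))).
Qed.

Lemma measurable_sum_indic (I : finType) (g : I -> G) (A : set (borel H)) :
  measurable A -> measurable_fun setT
    (fun y : borel H => (\sum_i (\1_A (act (g i) y) : R))%:E).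
Proof.
move=> mA.
apply/measurable_EFinP; apply: measurable_sum => i.
apply: (@measurable_indic _ _ _ _ (act (g i) @^-1` A : set (borel H))).
by rewrite -[X in measurable X]setTI; exact: measurable_act.
Qed.

Lemma sum_indic_le (I : finType) (g : I -> G) (A : set (borel H)) s :
  measurable A -> (forall y, \sum_i \1_A (act (g i) y) <= s) ->
  #|I|%:R * nuR A <= s.
Proof.
move=> mA As; rewrite -lee_fin -(integral_sum_indic g mA).
have [nu1 _] := hnu.
rewrite -[leRHS]mule1 -nu1 -integral_cst//; apply: ge0_le_integral => //.
- by move=> y _; rewrite lee_fin sumr_ge0// => i _; rewrite indicE.
- exact: measurable_sum_indic.
- by move=> y _; rewrite lee_fin.
Qed.

Lemma sum_indic_ge (I : finType) (g : I -> G) (A : set (borel H)) s :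
  0 <= s -> measurable A -> (forall y, s <= \sum_i \1_A (act (g i) y)) ->
  s <= #|I|%:R * nuR A.
Proof.
move=> s0 mA As; rewrite -lee_fin -(integral_sum_indic g mA).
have [nu1 _] := hnu.
rewrite -[leLHS]mule1 -nu1 -integral_cst//; apply: ge0_le_integral => //.
- exact: measurable_sum_indic.
- by move=> y _; rewrite lee_fin.
Qed.

(** The constant [c] approximates the integral of [f], but only sums of indicators need to be
    integrated to compare it with [nu A]. *)
Lemma avg_ge (I : finType) (g : I -> G) (f : H -> R) (A : set (borel H)) c e :
  (0 < #|I|)%N -> measurable A -> (forall y, \1_A y <= f y) ->
  (forall y, `|avg act g f y - c| <= e) -> nuR A - e <= c.
Proof.
move=> I0 mA Af fc; rewrite lerBlDr -(@ler_pM2l _ #|I|%:R) ?ltr0n//.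
apply: sum_indic_le => // y.
have := fc y; rewrite ler_distl => /andP[_]; rewrite ler_pdivrMr ?ltr0n// mulrC.
by apply: le_trans; apply: ler_sum.
Qed.

Lemma avg_le_measure (I : finType) (g : I -> G) (f : H -> R) (A : set (borel H)) c e :
  (0 < #|I|)%N -> measurable A -> (forall y, f y <= \1_A y) ->
  (forall y, `|avg act g f y - c| <= e) -> c <= nuR A + e.
Proof.
move=> I0 mA Af fc; rewrite -lerBlDr.
have nuA0 : 0 <= nuR A by rewrite fine_ge0.
have [?|ce] := leP (c - e) 0; first exact: le_trans nuA0.
rewrite -(@ler_pM2l _ #|I|%:R) ?ltr0n//.
apply: sum_indic_ge => // [|y]; first by rewrite mulr_ge0// ltW.
have := fc y; rewrite ler_distl => /andP[+ _]; rewrite ler_pdivlMr ?ltr0n// mulrC.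
by move=> /le_trans; apply; apply: ler_sum.
Qed.

(** The neighbourhoods of radius [1 / (n + 1)] decrease to [A] because [A] is closed; continuity of
    [nu] from above concludes. *)
Lemma outer_open (A : set H) e : closed A -> 0 < e ->
  exists U : set H, [/\ open U, A `<=` U & nuR (U `\` A) <= e].
Proof.
move=> cA e0.
pose U n : set H := \bigcup_(a in A) (ball a n.+1%:R^-1)^°.
have oU n : open (U n) by apply: bigcup_open => a _; exact: open_interior.
have AU n : A `<=` U n.
  by move=> a Aa; exists a => //; apply: nbhsx_ballx; rewrite invr_gt0.
have mUA n : measurable (U n `\` A : set (borel H)).
  by apply: measurableD; [exact: open_borel|exact: closed_borel].
have UA0 : \bigcap_n (U n `\` A) = set0.
  apply/seteqP; split => // y Uy; have [_ nAy] := Uy 0%N I.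
  apply: nAy; apply: cA => B /nbhs_ballP[d /= d0 dB].
  have [[a Aa] /interior_subset ay _] := Uy (Num.truncn d^-1) I.
  exists a; split => //; apply: dB; apply: ball_sym; apply: le_ball ay.
  rewrite -[leRHS]invrK lef_pV2 ?posrE ?invr_gt0//.
  exact/ltW/truncnS_gt.
have cv : nu (U n `\` A) @[n --> \oo] --> 0%E.
  rewrite -(measure0 nu) -UA0; apply: nonincreasing_cvg_mu => //.
  - by apply: le_lt_trans (nu_le1 (mUA 0%N)) _; rewrite ltry.
  - by rewrite UA0.
  - move=> n m nm; apply/subsetPset; apply: setSD => y [a Aa ay]; exists a => //.
    apply: filterS ay; apply: le_ball.
    by rewrite lef_pV2 ?posrE// ler_nat.
have [_ /cvgr0Pnorm_lt/(_ _ e0) [n _ nP]] := (fine_cvgP _ _).1 cv.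
exists (U n); split => //.
have := nP n (leqnn n); rewrite /= => /ltW; apply: le_trans; exact: ler_norm.
Qed.

Lemma urysohn_open (A U : set H) : closed A -> open U -> A `<=` U ->
  exists f : H -> R, [/\ continuous f, forall y, 0 <= f y <= 1,
    forall y, A y -> f y = 1 & forall y, ~ U y -> f y = 0].
Proof.
move=> cA oU AU.
have [||f [cf f0 f1 f01]] := @urysohn_ext_itv H R (compact_normal hH cH)
  (~` U) A 0 1 _ cA _ ltr01.
- exact: open_closedC.
- by rewrite setIC; apply/disjoints_subset; rewrite setCK.
exists f; split => // y.
- by have := f01 (f y); rewrite /= in_itv/=; apply; exists y.
- by move=> Ay; apply: f1; exists y.
- by move=> Uy; apply: f0; exists y.
Qed.

End haar.

(** * Independence from positive measure *)

Section independence.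
Variables (R : realType) (G : Type) (mul : G -> G -> G) (one : G) (inv : G -> G).
Variables (H : pseudoPMetricType R) (act : G -> H -> H).
Hypothesis hG : is_group mul one inv.
Hypothesis cH : compact [set: H].
Hypothesis hH : hausdorff_space H.
Hypothesis hact : cont_action mul one act.
Hypothesis hmin : minimal_system act.
Hypothesis heq : equicontinuous_system act.
Variable nu : {measure set (borel H) -> \bar R}.
Hypothesis hnu : invariant_borel_probability act nu.

Local Notation nuR A := (fine (nu A)).

(** A tree of points listed with the newest first: each point is close to some earlier one, and the
    allowed distance depends only on how many points came before. *)
Inductive chain (delta : nat -> R) : seq H -> Prop :=
| chain1 w : chain delta [:: w]
| chain_cons s w y : chain delta s -> w \in s -> ball w (delta (size s)) y ->
    chain delta (y :: s).

Section cost.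
Variables (delta eta : nat -> R) (F : H -> R) (Fk : nat -> H -> R).
Hypothesis Fk_delta : forall k g y y', ball y (delta k) y' ->
  `|Fk k (act g y) - Fk k (act g y')| <= eta k.

(** Here [w0] is the root of the chain, and [cost i] bounds the drop of [F] from the root to any
    other point under [g i]. Attaching [y] to [w] costs the two errors of replacing [F] by [Fk k] at
    [w] and [y], plus the variation [eta k] of [Fk k] between them. *)
Lemma chain_cost (I : finType) (g : I -> G) (e : R) n s : 0 <= e ->
  (0 < #|I|)%N -> (forall k, 0 <= eta k) ->
  (forall k y, (k < n)%N ->
    avg act g (fun y => `|F y - Fk k y|) y <= eta k + e) ->
  chain delta s -> (size s <= n)%N ->
  exists (w0 : H) (cost : I -> R),
    (forall i z, z \in s -> F (act (g i) w0) - F (act (g i) z) <= cost i) /\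
    (\sum_i cost i) / #|I|%:R <= \sum_(k < size s) (3 * eta k + 2 * e).
Proof.
move=> e0 I0 eta0 FFk; elim=> {s} [w|s w y cs IH ws wy] sn.
  exists w, (fun=> 0); split.
    by move=> i z; rewrite inE => /eqP ->; rewrite subrr.
  by rewrite big1 ?mul0r// sumr_ge0// => k _; have := eta0 k; lra.
have [w0 [cost [costP costE]]] := IH (ltnW sn).
pose E z i := `|F (act (g i) z) - Fk (size s) (act (g i) z)|.
exists w0, (fun i => cost i + (E w i + E y i + eta (size s))); split.
  move=> i z; rewrite inE => /orP[/eqP ->|zs]; last first.
    by apply: le_trans (costP i z zs) _; rewrite lerDl !addr_ge0 ?normr_ge0.
  have h1 := costP i w ws.
  have h2 : F (act (g i) w) - F (act (g i) y) <= E w i + E y i + eta (size s).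
    have := Fk_delta (g i) wy; rewrite /E.
    set a := F (act _ w); set b := F _; set c := Fk _ (act _ w); set d := Fk _ _.
    rewrite !ler_norml => /andP[_ cd].
    have := ler_norm (a - c); have := ler_norm (- (b - d)); rewrite normrN; lra.
  lra.
rewrite -[size (y :: s)]/(size s).+1 big_ord_recr/= !big_split/= mulrDl.
apply: lerD; first by move: costE; rewrite big_split.
rewrite 2!mulrDl.
have h z : (\sum_i E z i) / #|I|%:R <= eta (size s) + e by exact: FFk.
have := h w; have := h y.
have -> : (\sum_(i : I) eta (size s)) / #|I|%:R = eta (size s).
  by rewrite sumr_const -[X in X / _]mulr_natr mulfK// pnatr_eq0 -lt0n.
lra.
Qed.

End cost.

(* The admissible distances shrink with the length of the chain, so that the
   total proportion of translations lost along it stays below [nu A]. *)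
Lemma chain_return (A : set H) : closed A -> 0 < nuR A ->
  exists delta : nat -> R, (forall k, 0 < delta k) /\
    forall s, chain delta s -> forall O, open O -> A `<=` O ->
      exists g, forall w, w \in s -> O (act g w).
Proof.
move=> cA nuA; set a := nuR A in nuA.
(* The sums of [3 * eta k] stay below [a / 2]. *)
pose eta k : R := a / 12 * (1 / 2) ^+ k.
have eta0 k : 0 < eta k by rewrite mulr_gt0 ?exprn_gt0//; lra.
(* The functions [Fk k], and hence [delta], are built from [A] alone, before the neighbourhood [O]
   is given. *)
have [U UP] := choice (fun k => outer_open hnu cA (eta0 k)).
have [Fk FkP] := choice (fun k => let: And3 oU AU _ := UP k in
  urysohn_open cH hH cA oU AU).
have exd k : exists d : R, 0 < d /\
    forall g y y', ball y d y' -> `|Fk k (act g y) - Fk k (act g y')| <= eta k.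
  have [cF _ _ _] := FkP k.
  by have [d d0 hd] := orbit_equicontinuous cH hH heq cF (eta0 k); exists d.
have [delta deltaP] := choice exd.
exists delta; split=> [k|s cs O oO AO]; first by case: (deltaP k).
pose n := size s.
(* For [F] equal to 1 on [A] and vanishing off [V], the difference [|F - Fk k|] is bounded by the
   indicator of [U k] minus [A], a set of measure at most [eta k]. *)
pose V : set H := O `&` \bigcap_(k in `I_n) U k.
have oV : open V.
  apply: openI => //; rewrite -closedC setC_bigcap; apply: closed_bigcup => //.
  by move=> k _; rewrite closedC; have [] := UP k.
have AV : A `<=` V.
  by move=> y Ay; split; [exact: AO|move=> k _; have [_ AU _] := UP k; exact: AU].
have [F [cF F01 F1 F0]] := urysohn_open cH hH cA oV AV.
pose f k : H -> R := if k is j.+1 then (fun y => `|F y - Fk j y|) else F.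
have cf k : continuous (f k).
  case: k => [//|k] y; have [cFk _ _ _] := FkP k.
  by apply: (@continuous_comp _ _ _ (fun y => F y - Fk k y) (fun r => `|r|));
    [apply: cvgB; [exact: cF|exact: cFk]|exact: norm_continuous].
(* The errors [4 * e] accumulated over [n] points stay below [a / 4]. *)
pose e := a / (16 * n.+1%:R).
have e0 : 0 < e by rewrite divr_gt0// mulr_gt0.
have [I [g [c [I0 gc]]]] := avg_const_simul cH hH hact hmin heq n.+1 cf e0.
have c0 : a - e <= c 0%N.
  apply: (@avg_ge _ _ _ _ _ _ hact _ hnu _ g (f 0%N)) => //.
  - exact: closed_borel.
  - move=> y; rewrite indicE /f; case: (boolP (y \in A)) => [|_].
      by rewrite inE => /F1 ->.
    by have /andP[] := F01 y.
  - by move=> y; exact: gc.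
have ck k : (k < n)%N -> c k.+1 <= eta k + e.
  move=> kn; have [oU AU nuU] := UP k.
  apply: (@le_trans _ _ (nuR (U k `\` A) + e)); last by rewrite lerD2r.
  apply: (@avg_le_measure _ _ _ _ _ _ hact _ hnu _ g (f k.+1)) => //.
  - by apply: measurableD; [exact: open_borel|exact: closed_borel].
  - move=> y /=; have [cFk Fk01 Fk1 Fk0] := FkP k.
    have [Ay|nAy] := pselect (A y); first by rewrite F1// Fk1// subrr normr0 indicE.
    have [Uy|nUy] := pselect (U k y).
      rewrite indicE mem_set//= ler_norml.
      by have := Fk01 y; have := F01 y; lra.
    rewrite F0 ?Fk0 ?subrr ?normr0 ?indicE//.
    by move=> [_ /(_ k kn)].
  - by move=> y; exact: gc.
(* If every translation leaves some point of the chain outside [O], then [F] vanishes there, so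
   [F (act (g i) w0)] is at most [cost i]. Averaging over [i] would give [a - 2 * e] at most
   [a / 2 + 4 * e * n]. *)
apply: contrapT => /forallNP nog.
have FFk k y : (k < n)%N -> avg act g (fun y => `|F y - Fk k y|) y <= eta k + 2 * e.
  move=> kn; have := gc k.+1 y kn; rewrite ler_distl => /andP[_]; have := ck k kn.
  rewrite /f; lra.
have [|||w0 [cost [costP costE]]] :=
  chain_cost (fun k => (deltaP k).2) _ I0 _ FFk cs _ => //.
- lra.
- by move=> k; exact: ltW.
have : avg act g F w0 <= (\sum_i cost i) / #|I|%:R.
  rewrite ler_pM2r ?invr_gt0 ?ltr0n//; apply: ler_sum => i _.
  have /existsNP[z /not_implyP[zs nOz]] := nog (g i).
  have := costP i z zs; rewrite (F0 (act (g i) z)) ?subr0//.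
  by case.
move=> /le_trans/(_ costE).
have : a - 2 * e <= avg act g F w0.
  by have := gc 0%N w0 (ltn0Sn _); rewrite ler_distl => /andP[+ _]; rewrite /f; lra.
rewrite big_split/= sumr_const card_ord -/n.
have hsum m : \sum_(k < m) 3 * eta k = a / 2 * (1 - (1 / 2) ^+ m).
  elim: m => [|m IHm]; first by rewrite big_ord0 expr0 subrr mulr0.
  rewrite big_ord_recr/= IHm /eta exprSr; lra.
rewrite hsum.
have : 0 <= a / 2 * (1 / 2) ^+ n by rewrite mulr_ge0 ?exprn_ge0//; lra.
have en : e * n.+1%:R = a / 16.
  by rewrite /e invfM mulrA divfK// pnatr_eq0.
move: en; rewrite -natr1 -[2 * (2 * e) *+ n]mulr_natr.
move: ((1 / 2) ^+ n) n%:R => q N; lra.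
Qed.

(** Displaced copies attach to their originals in [s]; [rho] must respect the bounds for all lengths
    reached on the way. *)
Lemma chain_map_cat (delta : nat -> R) (phi : H -> H) (rho : R) s t :
  chain delta s -> (forall w, w \in t -> w \in s /\ ball w rho (phi w)) ->
  (forall k, (k < size t + size s)%N -> rho <= delta k) ->
  chain delta (map phi t ++ s).
Proof.
move=> cs; elim: t => [//|w t IH] tP rhod /=.
have [ws bw] := tP w (mem_head _ _).
apply: (@chain_cons _ _ w) => //.
- apply: IH => [z zt|k kt]; first by apply: tP; rewrite inE zt orbT.
  by apply: rhod; exact: ltnW.
- by rewrite mem_cat ws orbT.
- by apply: le_ball bw; apply: rhod; rewrite size_cat size_map.
Qed.

Lemma seq_ball_radius (N : H -> set H) (s : seq H) :
  (forall w, w \in s -> nbhs w (N w)) ->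
  exists2 rho : R, 0 < rho & forall w, w \in s -> ball w rho `<=` N w.
Proof.
elim: s => [|w s IH] sN; first by exists 1.
have [|r1 r10 r1P] := IH; first by move=> z zs; apply: sN; rewrite inE zs orbT.
have /nbhs_ballP[r2 /= r20 r2P] := sN w (mem_head _ _).
exists (Num.min r1 r2); first by rewrite lt_min r10.
move=> z; rewrite inE => /orP[/eqP ->|zs].
  by apply: subset_trans r2P; apply: le_ball; rewrite ge_min lexx orbT.
by apply: subset_trans (r1P z zs); apply: le_ball; rewrite ge_min lexx.
Qed.

Lemma seq_pos_lower_bound (delta : nat -> R) n : (forall k, 0 < delta k) ->
  exists2 rho : R, 0 < rho & forall k, (k < n)%N -> rho <= delta k.
Proof.
move=> d0; elim: n => [|n [r r0 rP]]; first by exists 1.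
exists (Num.min r (delta n)); first by rewrite lt_min r0 d0.
move=> k; rewrite ltnS leq_eqVlt => /orP[/eqP ->|kn].
  by rewrite ge_min lexx orbT.
by rewrite ge_min rP.
Qed.

(** Translate the whole chain close to [A]; there each point can be moved slightly into [D true] and
    into [D false]. Equicontinuity keeps the displacements small after translating back, and both
    displaced copies join the chain. *)
Lemma chain_step (A : set H) (D : bool -> set H) (delta : nat -> R) :
  (forall k, 0 < delta k) ->
  (forall s, chain delta s -> forall O, open O -> A `<=` O ->
    exists g, forall w, w \in s -> O (act g w)) ->
  (forall b, open (D b)) -> (forall b, A `<=` closure (D b)) ->
  forall (s : seq H) (gs : seq G), chain delta s ->
  exists (g : G) (s' : seq H), chain delta s' /\
    forall w b, w \in s -> exists w', [/\ w' \in s', D b (act g w') &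
      forall i c, (i < size gs)%N ->
        D c (act (nth one gs i) w) -> D c (act (nth one gs i) w')].
Proof.
move=> d0 ret oD AD s gs cs; have [act1 actM cact] := hact.
have [_ _ _ mulVg mulgV] := hG.
have actK g : cancel (act g) (act (inv g)) by move=> y; rewrite -actM mulVg.
have actVK g : cancel (act (inv g)) (act g) by move=> y; rewrite -actM mulgV.
(* Conditions already met by [w] are open, so they survive small displacements. *)
pose N w : set H := [set y | forall (i : 'I_(size gs)) c,
  D c (act (nth one gs i) w) -> D c (act (nth one gs i) y)].
have [w _|r1 r10 r1P] := @seq_ball_radius N s.
  apply: filter_forall => i; apply: filter_forall => c.
  have [Dw|nDw] := pselect (D c (act (nth one gs i) w)).
    have : nbhs w (act (nth one gs i) @^-1` D c).
      by apply: cact; exact: open_nbhs_nbhs.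
    by apply: filterS => y Dy _.
  by apply: nearW => y /nDw.
have [r2 r20 r2P] := seq_pos_lower_bound (size s + (size s + size s))%N d0.
pose rho := Num.min r1 r2.
have rho0 : 0 < rho by rewrite lt_min r10.
have rho2 : 0 < rho / 2 by lra.
have [d dpos hd] := heq rho2.
pose O : set H := \bigcup_(a in A) (ball a d)^°.
have oO : open O by apply: bigcup_open => a _; exact: open_interior.
have [|g gP] := ret s cs O oO.
  by move=> a Aa; exists a => //; exact: nbhsx_ballx.
have ex (wb : H * bool) : exists w', wb.1 \in s ->
    ball wb.1 rho w' /\ D wb.2 (act g w').
  case: wb => w b /=; case: (boolP (w \in s)) => [ws|_]; last by exists w.
  have [z Az /interior_subset zw] := gP w ws.
  have wz := hd _ _ zw (inv g); rewrite actK in wz.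
  have Nz : nbhs z (act (inv g) @^-1` ball (act (inv g) z) (rho / 2)).
    by apply: cact; exact: nbhsx_ballx.
  have [u [Du /= zu]] := AD b z Az _ Nz.
  exists (act (inv g) u) => _; rewrite actVK; split => //.
  have -> : rho = rho / 2 + rho / 2 by lra.
  exact: ball_triangle (ball_sym wz) zu.
have [phi phiP] := choice ex.
pose s1 := map (fun w => phi (w, true)) s ++ s.
exists g, (map (fun w => phi (w, false)) s ++ s1); split.
  have rhod k : (k < size s + (size s + size s))%N -> rho <= delta k.
    by move=> /r2P; apply: le_trans; rewrite ge_min lexx orbT.
  apply: (@chain_map_cat _ _ rho).
  - apply: (@chain_map_cat _ _ rho) => // [w ws|k kn].
      by have [] := phiP (w, true) ws.
    by apply: rhod; apply: leq_trans kn _; rewrite leq_addl.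
  - by move=> w ws; have [] := phiP (w, false) ws; rewrite mem_cat ws orbT.
  - by move=> k; rewrite size_cat size_map; exact: rhod.
move=> w b ws; exists (phi (w, b)); have [bw Dw] := phiP (w, b) ws.
split => //.
  by case: b {bw Dw}; rewrite !mem_cat (map_f (fun w => phi (w, _)) ws)// orbT.
move=> i c isz; apply: (r1P w ws _ _ (Ordinal isz)).
by apply: le_ball bw; rewrite ge_min lexx.
Qed.

Lemma independence (A : set H) (D : bool -> set H) : closed A -> 0 < nuR A ->
  (forall b, open (D b)) -> (forall b, A `<=` closure (D b)) ->
  exists g : nat -> G, forall (n : nat) (a : nat -> bool), exists h,
    forall i, (i < n)%N -> D (a i) (act (g i) h).
Proof.
move=> cA nuA oD AD.
have [delta [d0 ret]] := chain_return cA nuA.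
have stepP := chain_step d0 ret oD AD.
have ex (p : seq H * seq G) : exists q : G * seq H, chain delta p.1 ->
    chain delta q.2 /\
    forall w b, w \in p.1 -> exists w', [/\ w' \in q.2, D b (act q.1 w') &
      forall i c, (i < size p.2)%N ->
        D c (act (nth one p.2 i) w) -> D c (act (nth one p.2 i) w')].
  have [cp|ncp] := pselect (chain delta p.1); last by exists (one, [::]).
  by have [g [s' gs']] := stepP _ p.2 cp; exists (g, s').
have [f fP] := choice ex.
(* The state pairs the current chain with the translations chosen so far; after [n] steps the chain
   realises all patterns of length [n]. *)
pose st := fix st n := if n is m.+1 then ((f (st m)).2, rcons (st m).2 (f (st m)).1)
  else ([:: point : H], [::] : seq G).
pose g n := (f (st n)).1.
have chst n : chain delta (st n).1.
  by elim: n => [|n /fP[]//]; exact: chain1.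
have size_st n : size (st n).2 = n by elim: n => //= n; rewrite size_rcons => ->.
have nth_st n i : (i < n)%N -> nth one (st n).2 i = g i.
  elim: n => // n IH; rewrite ltnS leq_eqVlt /= nth_rcons size_st.
  by move=> /orP[/eqP ->|iltn]; rewrite ?ltnn ?eqxx// iltn IH.
exists g => n a; suff [h _ hP] : exists2 h, h \in (st n).1 &
    forall i, (i < n)%N -> D (a i) (act (g i) h) by exists h.
elim: n => [|n [w ws wP]]; first by exists point => //; rewrite mem_head.
have [_ /(_ w (a n) ws)[w' [ws' Dw' w'P]]] := fP _ (chst n).
exists w' => // i; rewrite ltnS leq_eqVlt => /orP[/eqP ->//|iltn].
have := w'P i (a i); rewrite size_st nth_st// => /(_ iltn); apply; exact: wP.
Qed.

End independence.

(** * Factors of minimal systems *)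

(** Nonempty open sets [V n] are nested with [closure (V n.+1)] inside [U n]; a cluster point of
    points chosen in them lies in every closure. *)
Lemma baire_compact (R : realType) (T : pseudoMetricType R) (U : nat -> set T) :
  compact [set: T] -> (forall n, open (U n) /\ dense (U n)) ->
  dense (\bigcap_n U n).
Proof.
move=> cT UP O O0 oO.
have ex (p : nat * set T) : exists V : set T, open p.2 -> p.2 !=set0 ->
    [/\ open V, V !=set0 & closure V `<=` p.2 `&` U p.1].
  case: p => n W /=; have [[oW W0]|nW] := pselect (open W /\ W !=set0); last first.
    by exists W => oW W0; exfalso; apply: nW.
  have [oU dU] := UP n; have [x [Wx Ux]] := dU W W0 oW.
  have /nbhs_ballP[e /= e0 eWU] : nbhs x (W `&` U n).
    by apply: open_nbhs_nbhs; split => //; exact: openI.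
  have e2 : 0 < e / 2 by lra.
  exists (ball x (e / 2))^° => _ _; split.
  - exact: open_interior.
  - by exists x; exact: nbhsx_ballx.
  - apply: subset_trans eWU.
    apply: (subset_trans (closure_subset (@interior_subset _ _))).
    have lt2 : e / 2 < e by lra.
    exact: subset_trans (closure_ballW e2 lt2) (@interior_subset _ _).
have [f fP] := choice ex.
pose V := fix V n := if n is m.+1 then f (m, V m) else O.
have VP n : open (V n) /\ V n !=set0.
  by elim: n => [//|n [oV V0]]; have [] := fP (n, V n) oV V0.
have VS n : closure (V n.+1) `<=` V n `&` U n.
  by have [oV V0] := VP n; have [] := fP (n, V n) oV V0.
have Vle n m : (n <= m)%N -> V m `<=` V n.
  elim: m => [|m IH]; first by rewrite leqn0 => /eqP ->.
  rewrite leq_eqVlt => /orP[/eqP -> //|nm].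
  apply: subset_trans (IH nm) => x /subset_closure /VS[]//.
have [v vP] := choice (fun n => (VP n).2).
have [x clx] := seq_cluster v cT.
have xV n : closure (V n) x.
  move=> B Bx; have [m nm Bm] := clx B Bx n.
  by exists (v m); split => //; exact: Vle nm _ (vP m).
exists x; split; first by have [] := VS 0%N x (xV 1%N).
by move=> n _; have [] := VS n x (xV n.+1).
Qed.

Section factor.
Variables (R : realType) (G : Type) (mul : G -> G -> G) (one : G) (inv : G -> G).
Variables (X : pseudoMetricType R) (H : pseudoPMetricType R).
Variables (act : G -> X -> X) (actH : G -> H -> H) (pi : X -> H).
Hypothesis hG : is_group mul one inv.
Hypothesis cX : compact [set: X].
Hypothesis hX : hausdorff_space X.
Hypothesis hH : hausdorff_space H.
Hypothesis hact : cont_action mul one act.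
Hypothesis hactH : cont_action mul one actH.
Hypothesis hmin : minimal_system act.
Hypothesis hpi : factor_map act actH pi.

Lemma factor_compact : compact [set: H].
Proof.
have [cpi spi _] := hpi.
have -> : [set: H] = pi @` [set: X].
  by apply/seteqP; split => // y _; have [x <-] := spi y; exists x.
by apply: continuous_compact => //; exact: continuous_subspaceT.
Qed.

Lemma factor_closed (C : set X) : closed C -> closed (pi @` C).
Proof.
move=> cC; have [cpi _ _] := hpi.
apply: compact_closed => //; apply: continuous_compact.
  exact: continuous_subspaceT.
exact: subclosed_compact cC cX _.
Qed.

Lemma factor_minimal : minimal_system actH.
Proof.
have [cpi spi epi] := hpi.
move=> h; apply/seteqP; split => // y _ B By.
have [x xh] := spi h; have [z zy] := spi y.
have : closure (Defs.orbit act x) z by rewrite hmin.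
rewrite -zy in By => /(_ _ (cpi z _ By)) [_ [[g _ <-] Bg]].
by exists (actH g h); split; [exists g|rewrite -xh -epi].
Qed.

(** Since [pi] and [psi] have the same kernel, each factors through the other uniformly
    continuously, which carries equicontinuity from [Y] to [H]. *)
Lemma factor_equicontinuous :
  has_equicontinuous_quotient mul one act [set p | pi p.1 = pi p.2] ->
  equicontinuous_system actH.
Proof.
move=> [Y [actY [psi [[_ hY] _ eqY [cpsi _ epsi] kerP]]]] e e0.
have [cpi spi epi] := hpi.
have [d1 d10 h1] : exists2 d : R, 0 < d &
    forall x x', ball (psi x) d (psi x') -> ball (pi x) e (pi x').
  by apply: unif_factor => // x x' /kerP.
have [d2 d20 h2] := eqY d1 d10.
have [d d0 hd] : exists2 d : R, 0 < d &
    forall x x', ball (pi x) d (pi x') -> ball (psi x) d2 (psi x').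
  by apply: unif_factor => // x x' xx'; apply/kerP.
exists d => // y y' yy' g.
have [x xy] := spi y; have [x' xy'] := spi y'.
rewrite -xy -xy' -!epi; apply: h1; rewrite !epsi; apply: h2; apply: hd.
by rewrite xy xy'.
Qed.

Lemma factor_semiopen (C : set X) : closed C -> C^° !=set0 ->
  (pi @` C)^° !=set0.
Proof.
move=> cC [x0 Cx0]; have [cpi spi epi] := hpi.
have [act1 actM cact] := hact; have [act1H actMH cactH] := hactH.
have [_ _ _ mulVg mulgV] := hG.
have ex x : exists g, C^° (act g x).
  have : closure (Defs.orbit act x) x0 by rewrite hmin.
  by move=> /(_ _ (nbhs_interior Cx0)) [_ [[g _ <-] Cg]]; exists g.
have [g gP] := choice ex.
have [|x|s sP] := @compact_finite_cover _ (fun x => act (g x) @^-1` C^°) => //.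
  by apply: cact; apply: nbhs_interior; exact: gP.
apply: contrapT => noint.
have avoid (t : seq X) : exists W : set H, [/\ open W, W !=set0 &
    forall x, x \in t -> W `<=` ~` (actH (g x) @^-1` (pi @` C))].
  elim: t => [|x t IH].
    by exists setT; split => //; [exact: openT|exists point].
  have [W [oO O0 Ot]] := IH.
  exists (W `&` ~` (actH (g x) @^-1` (pi @` C))); split.
  - apply: openI => //; rewrite openC; apply: closed_comp.
      by move=> y _; exact: cactH.
    exact: factor_closed.
  - apply: contrapT => W'0; apply: noint; have [y Oy] := O0.
    exists (actH (g x) y).
    have : nbhs (actH (g x) y) (actH (inv (g x)) @^-1` W).
      apply: cactH; rewrite -actMH mulVg act1H; exact: open_nbhs_nbhs.
    apply: filterS => z Oz; apply: contrapT => nz; apply: W'0.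
    exists (actH (inv (g x)) z); split => //=.
    by rewrite -actMH mulgV act1H.
  - move=> z; rewrite inE => /orP[/eqP ->|zt]; first exact: subIsetr.
    exact: subset_trans (@subIsetl _ _ _) (Ot z zt).
have [W [_ [y Oy] Os]] := avoid s.
have [x xy] := spi y; have [z zs /= Cz] := sP x.
apply: (Os z zs y Oy) => /=; exists (act (g z) x); first exact: interior_subset Cz.
by rewrite epi xy.
Qed.

End factor.

(** * Tameness *)

Lemma card_seqP (T : choiceType) (F : set T) n : (F #= `I_n)%card <->
  exists s : seq T, [/\ uniq s, size s = n & forall z, F z <-> z \in s].
Proof.
split=> [/card_set_bijP[f [fI finj fS]]|[s [us sn Fs]]]; last first.
  apply/card_set_bijP; exists (fun z => index z s); split.
  - by move=> z /Fs zs; rewrite /= -sn index_mem.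
  - by move=> y z; rewrite !inE => /Fs ys /Fs zs; exact: index_inj.
  - move=> i /= ilt; case: s us sn Fs => [_ sn|z s us sn Fs].
      by rewrite -sn in ilt.
    exists (nth z (z :: s) i); last by rewrite index_uniq// sn.
    by apply/Fs; rewrite mem_nth// sn.
have ex (i : 'I_n) : exists z, F z /\ f z = i.
  by have [z Fz fz] := fS i (ltn_ord i); exists z.
have [x xP] := choice ex.
exists [seq x i | i <- enum 'I_n]; split.
- rewrite map_inj_uniq ?enum_uniq// => i j xij.
  by apply/val_inj; rewrite /= -(xP i).2 -(xP j).2 xij.
- by rewrite size_map size_enum_ord.
- move=> z; split=> [Fz|/mapP[i _ ->]]; last exact: (xP i).1.
  have fzn := fI z Fz; apply/mapP; exists (Ordinal fzn); first by rewrite mem_enum.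
  by apply: finj; rewrite ?inE ?(xP _).2//; exact: (xP _).1.
Qed.

Lemma card_trichotomy (T : choiceType) (F : set T) n :
  [\/ exists2 m, (m < n)%N & (F #= `I_m)%card, (F #= `I_n)%card |
    exists s : seq T, [/\ uniq s, size s = n.+1 & forall z, z \in s -> F z]].
Proof.
elim: n => [|n [[m mn Fm]|Fn|[s [us sn sF]]]].
- have [[z Fz]|F0] := pselect (F !=set0).
    apply: Or33; exists [:: z]; split => // y; by rewrite inE => /eqP ->.
  apply: Or32; apply/card_seqP; exists [::]; split => // z; split => // Fz.
  by exfalso; apply: F0; exists z.
- by apply: Or31; exists m => //; exact: ltnW.
- by apply: Or31; exists n.
- have [[z [Fz zs]]|nz] := pselect (exists z, F z /\ z \notin s).
    apply: Or33; exists (z :: s); split; rewrite /= ?zs ?sn// => y.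
    by rewrite inE => /orP[/eqP ->//|/sF].
  apply: Or32; apply/card_seqP; exists s; split => // z; split; last exact: sF.
  by move=> Fz; apply: contrapT => /negP zs; apply: nz; exists z.
Qed.

Lemma ptws_nbhs (S : eqType) (X : topologicalType) (q : {ptws S -> X}) (x : S)
  (N : set X) :
  nbhs (q x) N -> nbhs q [set f : {ptws S -> X} | N (f x)].
Proof. exact: (@proj_continuous S (fun=> X) x q). Qed.

Lemma ptws_compact (S : eqType) (X : topologicalType) :
  compact [set: X] -> compact [set: {ptws S -> X}].
Proof.
move=> cX; have := @tychonoff S (fun=> X) (fun=> setT) (fun=> cX).
by congr compact; apply/seteqP; split.
Qed.

Section tame.
Variables (R : realType) (G : Type).
Variables (X : pseudoMetricType R) (act : G -> X -> X).
Hypothesis cX : compact [set: X].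
Hypothesis hX : hausdorff_space X.
Hypothesis cact : forall g, continuous (act g).
Hypothesis htame : tame act.

(* Along a pointwise convergent subsequence of [g], convergence fails at the
   tuple [p] coding the parity of the position in that subsequence. *)
Lemma tame_no_independence (K : nat) (C1 C : set X) (g : nat -> G) :
  closed C1 -> C1 `<=` C^° ->
  (forall a : nat -> bool, exists p : 'I_K -> X, forall i,
    if a i then exists l, C1 (act (g i) (p l))
    else forall l, ~ C^° (act (g i) (p l))) -> False.
Proof.
move=> cC1 C1C indep; have [_ frechet] := htame.
pose u n : {ptws X -> X} := act (g n).
have [q clq] := seq_cluster u (@ptws_compact X X cX).
(* The pattern true only at [i] tells [u i] from [u j]. *)
have inj i j : (i < j)%N -> u i <> u j.
  move=> ij uij; have [p pP] := indep (pred1 i).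
  have := pP i; rewrite /= eqxx => -[l Cl].
  have := pP j; rewrite /= gtn_eqF// => /(_ l); apply.
  by rewrite -[act _]uij; exact: C1C.
(* Discarding the terms up to a possible occurrence of [q] ensures that a sequence converging to [q]
   cannot repeat one index forever. *)
have [N NP] : exists N, forall n, (N <= n)%N -> u n <> q.
  have [[n un]|nu] := pselect (exists n, u n = q).
    by exists n.+1 => m nm; rewrite -un => /esym; exact: inj.
  by exists 0%N => n _ un; apply: nu; exists n.
pose A : set {ptws X -> X} := [set u n | n in [set n | (N <= n)%N]].
have subE f : (exists n, u n = f) -> enveloping act f.
  by move=> [n <-]; apply: subset_closure; exists (g n).
have [v [vA vq]] : exists v : nat -> {ptws X -> X}, (forall n, A (v n)) /\ v @ \oo --> q.
  apply: frechet.
  - by move=> f [n _ <-]; apply: subE; exists n.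
  - move=> B Bq; have [n _ Bn] := clq B Bq 0%N.
    by exists (u n); split => //; exists (g n).
  - move=> B Bq; have [n Nn Bn] := clq B Bq N.
    by exists (u n); split => //; exists n.
have exn k : exists n, (N <= n)%N /\ u n = v k by have [n Nn <-] := vA k; exists n.
have [n nP] := choice exn.
have evq x B : nbhs (q x) B -> exists k0, forall k, (k0 <= k)%N -> B (u (n k) x).
  move=> /ptws_nbhs /vq [k0 _ k0P]; exists k0 => k k0k.
  by rewrite (nP k).2; exact: k0P.
have n_large M : exists k0, forall k, (k0 <= k)%N -> (M <= n k)%N.
  elim: M => [|M [k0 k0P]]; first by exists 0%N.
  have [NM|MN] := leqP N M; last first.
    by exists 0%N => k _; apply: leq_trans MN _; exact: (nP k).1.
  have [x ux] : exists x, u M x <> q x.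
    apply: contrapT => /forallNP ne; apply: (NP M NM); apply/funext => x.
    by apply: contrapT; exact: ne.
  have [|k1 k1P] := evq x (~` [set u M x]).
    apply: open_nbhs_nbhs; split; last by move=> /esym.
    by rewrite openC; apply: accessible_closed_set1; exact: hausdorff_accessible.
  exists (maxn k0 k1) => k; rewrite geq_max => /andP[h0 h1].
  rewrite ltn_neqAle k0P// andbT; apply/eqP => Mn.
  by apply: (k1P k h1); rewrite -Mn.
have exnext k : exists k', (k < k')%N /\ (n k < n k')%N.
  have [k0 k0P] := n_large (n k).+1.
  by exists (maxn k0 k.+1); rewrite leq_max ltnSn orbT k0P// leq_max leqnn.
have [next nextP] := choice exnext.
pose phi j := iter j next 0%N.
have phi_ge j : (j <= phi j)%N.
  by elim: j => // j IH; apply: leq_ltn_trans IH _; have [] := nextP (phi j).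
have nphi i j : (i < j)%N -> (n (phi i) < n (phi j))%N.
  elim: j => // j IH; rewrite ltnS leq_eqVlt => /orP[/eqP ->|/IH ij].
    by have [] := nextP (phi j).
  by apply: ltn_trans ij _; have [] := nextP (phi j).
have nphi_inj i j : n (phi i) = n (phi j) -> i = j.
  by move=> e; have [/nphi|/nphi|//] := ltngtP i j; rewrite e ltnn.
(* The pattern is true exactly at the even positions of the subsequence. The odd ones keep each
   [q (p l)] out of [C1]. *)
have [p pP] := indep (fun i => `[< exists j, i = n (phi j.*2) >]).
have p_even j : exists l, C1 (u (n (phi j.*2)) (p l)).
  by have := pP (n (phi j.*2)); case: asboolP => // -[]; exists j.
have p_odd j l : ~ C^° (u (n (phi j.*2.+1)) (p l)).
  have := pP (n (phi j.*2.+1)); case: asboolP => [[i /nphi_inj e]|_]; last exact.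
  by have := odd_double i; rewrite -e /= odd_double.
have qC l : ~ C1 (q (p l)).
  move=> /C1C Cq; have [|k kP] := evq (p l) C^°.
    by apply: open_nbhs_nbhs; split => //; exact: open_interior.
  apply: (p_odd k l); apply: kP; apply: leq_trans (phi_ge _).
  by rewrite ltnW// ltnS -addnn leq_addr.
have exk l : exists k0, forall k, (k0 <= k)%N -> ~ C1 (u (n k) (p l)).
  by apply: (evq (p l) (~` C1)); apply: open_nbhs_nbhs; split; [rewrite openC|exact: qC].
have [k0 k0P] := choice exk.
(* Finiteness of ['I_K] gives a rank beyond which no coordinate visits [C1], contrary to the even
   positions. *)
have [l] := p_even (\max_l k0 l).
apply: k0P; apply: leq_trans (phi_ge _).
by apply: leq_trans (leq_bigmax l) _; rewrite -addnn leq_addr.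
Qed.

End tame.

(** * Defect sets have measure zero *)

Section defect.
Variables (R : realType) (G : Type) (mul : G -> G -> G) (one : G) (inv : G -> G).
Variables (X : pseudoMetricType R) (H : pseudoPMetricType R).
Variables (act : G -> X -> X) (actH : G -> H -> H) (pi : X -> H).
Hypothesis hG : is_group mul one inv.
Hypothesis cX : compact [set: X].
Hypothesis hX : hausdorff_space X.
Hypothesis hH : hausdorff_space H.
Hypothesis hact : cont_action mul one act.
Hypothesis hactH : cont_action mul one actH.
Hypothesis hmin : minimal_system act.
Hypothesis hpi : factor_map act actH pi.
Hypothesis heq : equicontinuous_system actH.
Variable nu : {measure set (borel H) -> \bar R}.
Hypothesis hnu : invariant_borel_probability actH nu.
Hypothesis htame : tame act.
Variable K : nat.
Hypothesis hK : almost_K_to_one pi K.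

Lemma fiber_card_dense : dense (fiber_card_set pi K).
Proof.
have [U [UP UK]] := hK; have cH := factor_compact cX hpi.
by move=> O O0 oO; have [h [Oh /UK]] := baire_compact cH UP O0 oO; exists h.
Qed.

Lemma fiber_card_enum n h : fiber_card_set pi n h ->
  exists x : 'I_n -> X, (forall l, pi (x l) = h) /\
    forall z, pi z = h -> exists l, x l = z.
Proof.
move=> /card_seqP[s [_ <- sP]]; exists (tnth (in_tuple s)); split=> [l|z zh].
  by apply/sP; exact: mem_tnth.
by have /sP/(tnthP (in_tuple s))[l ->] := zh; exists l.
Qed.

Lemma defect_null (B C1 C : set X) : closed B -> closed C1 -> closed C ->
  B `<=` C1^° -> C1 `<=` C^° ->
  nu ((pi @` B) `&` closure (~` (pi @` C))) = 0%E.
Proof.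
move=> cB cC1 cC BC1 C1C; set A := _ `&` _.
have [cpi spi epi] := hpi.
have [act1 actM cact] := hact; have [act1H actMH cactH] := hactH.
have [_ _ _ mulVg mulgV] := hG.
have closed_img D : closed D -> closed (pi @` D) by exact: (factor_closed cX hH hpi).
have cA : closed A by apply: closedI; [exact: closed_img|exact: closed_closure].
have mA := closed_borel cA.
apply: contrapT => nuA.
have {}nuA : 0 < fine (nu A).
  rewrite lt0r fine_ge0// andbT; apply/eqP => fA; apply: nuA.
  by rewrite (nuRE hnu mA) fA.
pose D (b : bool) : set H := if b then (pi @` C1)^° else ~` (pi @` C).
have oD b : open (D b).
  by case: b => /=; [exact: open_interior|rewrite openC; exact: closed_img].
have AD b : A `<=` closure (D b).
  case: b => [|h [] //] _ [[x Bx <-] _] N Nx.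
  have [V Vx [cV VN]] : exists2 V, nbhs x V & closed V /\ V `<=` C1 `&` pi @^-1` N.
    have /nbhs_ballP[e /= e0 eN] : nbhs x (C1 `&` pi @^-1` N).
      by apply: filterI; [exact: BC1|exact: cpi].
    have e2 : 0 < e / 2 by lra.
    exists (closure (ball x (e / 2))).
      by apply: filterS (nbhsx_ballx x _ e2); exact: subset_closure.
    split; first exact: closed_closure.
    apply: subset_trans eN.
    have lt2 : e / 2 < e by lra.
    exact: subset_trans (closure_ballW e2 lt2) (@interior_subset _ _).
  have [|y Vy] := factor_semiopen hG cX hH hact hactH hmin hpi cV.
    by exists x.
  exists y; split.
    by apply: filterS Vy => _ [z /VN[C1z _] <-]; exists z.
  by have [z /VN[_ Nz] <-] := interior_subset Vy.
have cH := factor_compact cX hpi.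
have hminH := factor_minimal hmin hpi.
have [g gP] := independence hG cH hH hactH hminH heq hnu cA nuA oD AD.
apply: (@tame_no_independence _ _ _ _ cX hX htame K C1 C g cC1 C1C) => a.
have ex n : exists x : {ptws 'I_K -> X}, forall i, (i < n)%N ->
    if a i then exists l, C1 (act (g i) (x l))
    else forall l, ~ C (act (g i) (x l)).
  have [h hP] := gP n a.
  (* A finite pattern is an open condition on the base point, so it also holds at some [h'] whose
     fibre has exactly [K] points. *)
  have oU : open (\bigcap_(i in `I_n) (actH (g i) @^-1` D (a i))).
    rewrite -closedC setC_bigcap; apply: closed_bigcup => //.
    move=> i _; rewrite closedC; apply: open_comp => // y _; exact: cactH.
  have [h' [Uh' /fiber_card_enum[x [xh' xS]]]] := fiber_card_dense
    (ex_intro _ h hP) oU.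
  exists x => i iltn; have := Uh' i iltn; rewrite /preimage /= /D.
  case: (a i) => [/interior_subset[z Cz zh]|nC l Cl].
    have [|l lE] := xS (act (inv (g i)) z).
      by rewrite epi zh -actMH mulVg act1H.
    by exists l; rewrite lE -actM mulgV act1.
  by apply: nC; exists (act (g i) (x l)) => //; rewrite epi xh'.
have [u uP] := choice ex.
(* Meeting the closed set [C1] and missing the open interior of [C] both pass to the cluster point,
   as there are only [K] coordinates. *)
have [p clp] := seq_cluster u (@ptws_compact 'I_K X cX).
have near_act i l (N : set X) : open N -> N (act (g i) (p l)) ->
    nbhs p [set f : {ptws 'I_K -> X} | N (act (g i) (f l))].
  move=> oN Np; apply: (@ptws_nbhs _ _ p l (act (g i) @^-1` N)).
  by apply: cact; exact: open_nbhs_nbhs.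
exists p => i; case: (boolP (a i)) => ai.
  apply: contrapT => /forallNP nC.
  have near_nC : \forall f \near (p : {ptws 'I_K -> X}),
      forall l : 'I_K, ~ C1 (act (g i) (f l)).
    refine (@filter_forall {ptws 'I_K -> X} _ (fun l f => ~ C1 (act (g i) (f l)))
      (nbhs p) _ _) => l.
    by apply: (near_act i l (~` C1)); [rewrite openC|exact: nC].
  have [m im nCm] := clp _ near_nC i.+1.
  by have := uP m i im; rewrite ai => -[l /nCm].
move=> l Cl; have [m im Cm] := clp _ (near_act i l _ (open_interior _) Cl) i.+1.
by have := uP m i im; rewrite (negbTE ai) => /(_ l); apply; exact: interior_subset.
Qed.

End defect.

(** * Fibre cardinalities *)

Lemma ball_separated (R : realType) (X : pseudoMetricType R) (I : finType) (x : I -> X) :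
  hausdorff_space X -> injective x ->
  exists n, forall i j, ball (x i) n.+1%:R^-1 (x j) -> i = j.
Proof.
move=> hX xinj.
have ex (ij : I * I) : exists n, ball (x ij.1) n.+1%:R^-1 (x ij.2) -> ij.1 = ij.2.
  case: ij => i j /=; have [<-|ij] := pselect (i = j); first by exists 0%N.
  apply: contrapT => /forallNP nb; apply: ij; apply: xinj.
  apply: hausdorff_ball_eq => // e e0.
  have /not_implyP[b _] := nb (Num.truncn e^-1).
  apply: le_ball b; rewrite -[leRHS]invrK lef_pV2 ?posrE ?invr_gt0//.
  exact/ltW/truncnS_gt.
have [n nP] := choice ex.
exists (\max_ij n ij) => i j b; apply: (nP (i, j)); apply: le_ball b.
by rewrite lef_pV2 ?posrE// ler_nat ltnS; exact: (leq_bigmax (i, j)).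
Qed.

Section fibers.
Variables (R : realType) (G : Type) (mul : G -> G -> G) (one : G) (inv : G -> G).
Variables (X : pseudoMetricType R) (H : pseudoPMetricType R).
Variables (act : G -> X -> X) (actH : G -> H -> H) (pi : X -> H).
Hypothesis hG : is_group mul one inv.
Hypothesis cX : compact [set: X].
Hypothesis hX : hausdorff_space X.
Hypothesis hH : hausdorff_space H.
Hypothesis hact : cont_action mul one act.
Hypothesis hactH : cont_action mul one actH.
Hypothesis hmin : minimal_system act.
Hypothesis hpi : factor_map act actH pi.
Variable K : nat.
Hypothesis hK : almost_K_to_one pi K.

(* A fibre with [m] points forces the fibres over the dense orbit of its base
   point, hence the generic fibres, to be covered by [m] arbitrarily small
   balls. *)
Lemma fiber_card_ge h m : (m < K)%N -> ~ fiber_card_set pi m h.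
Proof.
move=> mK /fiber_card_enum[c [_ cS]].
have [cpi spi epi] := hpi; have [act1 actM cact] := hact.
have [act1H actMH cactH] := hactH; have [_ _ _ mulVg mulgV] := hG.
pose W n (c : 'I_m -> X) : set X := \bigcup_l (ball (c l) n.+1%:R^-1)^°.
(* These are the base points whose fibre is contained in some [W n c]. *)
pose U n : set H := \bigcup_c ~` (pi @` (~` W n c)).
have oU n : open (U n).
  apply: bigcup_open => c' _; rewrite openC; apply: (factor_closed cX hH hpi).
  by rewrite closedC; apply: bigcup_open => l _; exact: open_interior.
have dU n : dense (U n).
  move=> O [y Oy] oO.
  have : closure (Defs.orbit actH h) y by rewrite (factor_minimal hmin hpi).
  move=> /(_ _ (open_nbhs_nbhs (conj oO Oy))) [_ [[g _ <-] Ogh]].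
  exists (actH g h); split => //; exists (fun l => act g (c l)) => //.
  move=> [z nWz zgh]; apply: nWz.
  have [|l cl] := cS (act (inv g) z).
    by rewrite epi zgh -actMH mulVg act1H.
  exists l => //; rewrite cl -actM mulgV act1; exact: nbhsx_ballx.
have [V [VP VK]] := hK.
have cH := factor_compact cX hpi.
have UVP n : open (U n `&` V n) /\ dense (U n `&` V n).
  have [oV dV] := VP n; split; first exact: openI.
  exact: denseI.
have [|h0 [_ h0UV]] := @baire_compact _ _ _ cH UVP setT _ openT; first by exists h.
have /VK/card_seqP[s [us sK sP]] : (\bigcap_n V n) h0.
  by move=> n _; have [] := h0UV n I.
pose x := tnth (in_tuple s).
have xinj : injective x by exact/tuple_uniqP.
have [n nP] := ball_separated hX xinj.
(* At this index the radius is [1 / (2 * n + 2)], so two points in one ball are within [1 / (n + 1)]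
   and coincide: [K] points inject into [m] balls. *)
have [[c' _ c'P] _] := h0UV n.*2.+1 I.
have ex i : exists l, ball (c' l) n.*2.+2%:R^-1 (x i).
  have : W n.*2.+1 c' (x i).
    apply: contrapT => nW; apply: c'P; exists (x i) => //.
    by apply/sP; exact: mem_tnth.
  by move=> [l _ /interior_subset b]; exists l.
have [l lP] := choice ex.
have linj : injective l.
  move=> i j lij; apply: nP.
  have -> : n.+1%:R^-1 = n.*2.+2%:R^-1 + n.*2.+2%:R^-1 :> R.
    by rewrite -doubleS -muln2 natrM invfM; move: (n.+1%:R^-1) => t; lra.
  by apply: ball_triangle (lP j); apply: ball_sym; rewrite -lij.
by have := leq_card l linj; rewrite !card_ord sK leqNgt mK.
Qed.

End fibers.

(** * Covering the exceptional fibres by defect sets *)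

Theorem theorem1p4 (R : realType)
  (G : Type) (mul : G -> G -> G) (one : G) (inv : G -> G)
  (hG : is_group mul one inv)
  (hGcount : countable [set: G]) (hGinf : infinite_set [set: G])
  (X : pseudoMetricType R) (act : G -> X -> X)
  (hX : compact_metric X) (hact : cont_action mul one act)
  (hmin : minimal_system act) (htame : tame act)
  (H : pseudoPMetricType R) (actH : G -> H -> H) (pi : X -> H)
  (hmef : max_equicontinuous_factor mul one act actH pi)
  (nu : {measure set (borel H) -> \bar R})
  (hnu : invariant_borel_probability actH nu)
  (K : nat) (hK : almost_K_to_one pi K) :
  measurable (fiber_card_set pi K : set (borel H)) /\
  nu (fiber_card_set pi K) = 1%E.
Proof.
have [cX hsX] := hX; have [[_ hH] hactH hpi [_ hquot _]] := hmef.
have heq := factor_equicontinuous cX hH hpi hquot.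
have [cpi spi epi] := hpi; have [x0 _] := spi point.
pose r n : R := n.+1%:R^-1.
have r0 n : 0 < r n by rewrite invr_gt0.
have excov n : exists s : seq X, forall y, exists2 x, x \in s & ball x (r n) y.
  by apply: compact_finite_cover => // x; exact: nbhsx_ballx.
have [cov covP] := choice excov.
(* The multiples 1, 2 and 3 of the radius supply the nested triple for [defect_null]; the centres
   run through a finite [r n]-net. *)
pose B (j n k : nat) : set X := closure (ball (nth x0 (cov n) k) (j%:R * r n)).
have cB j n k : closed (B j n k) by exact: closed_closure.
have BS i j n k : (0 < i)%N -> (i < j)%N ->
    B i n k `<=` (ball (nth x0 (cov n) k) (j%:R * r n))^°.
  by move=> i0 ij; apply: closure_ballW; rewrite ?mulr_gt0 ?ltr0n// ltr_pM2r// ltr_nat.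
have BI i j n k : (0 < i)%N -> (i < j)%N -> B i n k `<=` (B j n k)^°.
  move=> i0 ij; apply: subset_trans (BS i j n k i0 ij) _.
  by apply: interiorS; exact: subset_closure.
pose defect n k : set H := pi @` B 1%N n k `&` closure (~` (pi @` B 3%N n k)).
have closed_img D : closed D -> closed (pi @` D) by exact: (factor_closed cX hH hpi).
have defect0 n k : nu.-negligible (defect n k : set (borel H)).
  apply/negligibleP; last first.
    exact: (defect_null hG cX hsX hH hact hactH hmin hpi heq hnu htame hK
      (cB _ _ _) (cB 2%N _ _) (cB _ _ _) (BI _ _ _ _ _ _) (BI _ _ _ _ _ _)).
  by apply: closed_borel; apply: closedI; [exact: closed_img|exact: closed_closure].
pose disj n (f : {ffun 'I_K.+1 -> nat}) :=
  forall i j z, B 3%N n (f i) z -> B 3%N n (f j) z -> i = j.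
pose T (p : nat * {ffun 'I_K.+1 -> nat}) : set H :=
  [set h | disj p.1 p.2 /\ forall i, (pi @` B 1%N p.1 (p.2 i)) h].
pose M : set H := \bigcup_p T p.
have disjK n f h : disj n f -> (forall i, (pi @` B 3%N n (f i)) h) ->
    ~ fiber_card_set pi K h.
  move=> d hB /fiber_card_enum[x [_ xS]].
  have ex i : exists l, B 3%N n (f i) (x l).
    by have [z Bz /xS[l xl]] := hB i; exists l; rewrite xl.
  have [l lP] := choice ex.
  have linj : injective l.
    move=> i j lij.
    by apply: (d i j (x (l i))); [exact: lP|rewrite lij; exact: lP].
  by have := leq_card l linj; rewrite !card_ord ltnn.
have mM : measurable (M : set (borel H)).
  apply: countable_bigcupT_measurable => [|[n f]]; first exact: countableP.
  have [d|nd] := pselect (disj n f); last first.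
    rewrite (_ : T (n, f) = set0)//.
    by apply/seteqP; split => // h [].
  rewrite (_ : T (n, f) = \bigcap_i (pi @` B 1%N n (f i))).
    by apply: closed_borel; apply: closed_bigI => i _; exact: closed_img.
  apply/seteqP; split=> h; first by move=> [_ hT] i _; exact: hT.
  by move=> hT; split=> // i; exact: hT.
have MN : M `<=` \bigcup_n \bigcup_k defect n k.
  move=> h [[n f] _ [d hT]]; apply: contrapT => nh.
  (* Outside all defect sets, every fibre near [h] would meet the same [K + 1] disjoint sets, but
     [K]-point fibres are dense. *)
  have near_h : nbhs h (\bigcap_(i in [set: 'I_K.+1]) (pi @` B 3%N n (f i))).
    have : \forall y \near h, forall i, (pi @` B 3%N n (f i)) y.
      apply: filter_forall => i.
      have : ~ closure (~` (pi @` B 3%N n (f i))) h.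
        by move=> cl; apply: nh; exists n => //; exists (f i).
      by rewrite closure_setC => /contrapT.
    by apply: filterS => y yP i _; exact: yP.
  have [h' [h'B]] := fiber_card_dense cX hpi hK
    (ex_intro (interior _) h near_h) (@open_interior _ _).
  by apply: disjK d _ => i; exact: (interior_subset h'B i I).
have -> : fiber_card_set pi K = ~` M.
  apply/seteqP; split=> [h hKh [[n f] _ [d hT]]|h nM].
    apply: disjK d _ hKh => i; have [z Bz <-] := hT i; exists z => //.
    exact: interior_subset (BI 1%N 3%N n (f i) isT isT z Bz).
  have [[m mK hm]|//|[s [us sK sh]]] := card_trichotomy (pi @^-1` [set h]) K.
    by exfalso; exact: (fiber_card_ge hG cX hsX hH hact hactH hmin hpi hK mK hm).
  exfalso; apply: nM.
  pose x (i : 'I_K.+1) := nth x0 s i.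
  have xinj : injective x.
    by move=> i j /eqP; rewrite /x nth_uniq ?sK// => /eqP/val_inj.
  have [n0 n0P] := ball_separated hsX xinj.
  (* This gives [10 * r n = 1 / (n0 + 1)]. If the tripled sets around [x i] and [x j] met, these
     points would be within [(1 + 4 + 4 + 1) * r n], where 4 replaces 3 to absorb the closure. *)
  pose n := (10 * n0 + 9)%N.
  have rn : r n * 10 = n0.+1%:R^-1.
    have -> : r n = (n0.+1%:R * 10)^-1.
      by rewrite /r -natrM /n mulnC; congr (_%:R^-1); lia.
    by rewrite invfM mulfVK.
  have exk i : exists k, ball (nth x0 (cov n) k) (r n) (x i).
    by have [c cn bc] := covP n (x i); exists (index c (cov n)); rewrite nth_index.
  have [k kP] := choice exk.
  exists (n, [ffun i => k i]) => //; split=> [i j z|i] /=; rewrite !ffunE; last first.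
    exists (x i); first by apply: subset_closure; rewrite mul1r.
    by apply: sh; rewrite mem_nth ?sK.
  move=> /(BS 3%N 4%N _ _ isT isT) /interior_subset zi.
  move=> /(BS 3%N 4%N _ _ isT isT) /interior_subset zj.
  apply: n0P; rewrite -rn.
  have -> : r n * 10 = r n + 4 * r n + (4 * r n + r n) by lra.
  apply: ball_triangle (ball_triangle (ball_sym (kP i)) zi) _.
  exact: ball_triangle (ball_sym zj) (kP j).
split; first exact: measurableC.
have [nu1 _] := hnu.
have -> : ~` M = [set: borel H] `\` M by rewrite setTD.
rewrite measureD//; last by rewrite [ltLHS]nu1 ltry.
rewrite setTI [X in (X - _)%E]nu1.
rewrite [X in (_ - X)%E](_ : _ = 0%E) ?sube0//.
apply: measure_negligible mM _.
apply: (@negligibleS _ (borel H) _ nu (\bigcup_n \bigcup_k defect n k)) => //.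
by apply: negligible_bigcup => n; exact: negligible_bigcup.
Qed.
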